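(* Let $X$ be a non-zero, separable, reflexive Banach space. For every $S \in \mathcal{B}(Y_X)$ there exists a unique $\Theta(S) \in \mathcal{B}(X)$ for which there exists a club subset $D \subseteq [0, \omega_1)$ such that for all $\alpha \in D$ and all $\psi \in X^*$: $$S^*(\delta_{\alpha} \otimes \psi) = \delta_{\alpha} \otimes \Theta(S)^* \psi.$$ Moreover, the map $\Theta: \mathcal{B}(Y_X) \rightarrow \mathcal{B}(X)$, $S \mapsto \Theta(S)$, is a non-injective algebra homomorphism of norm one; and there exists an algebra homomorphism $\Lambda: \mathcal{B}(X) \rightarrow \mathcal{B}(Y_X)$ of norm one with $\Theta \circ \Lambda = \mathrm{id}_{\mathcal{B}(X)}$. In particular, $\Theta$ is surjective.
   Context: All Banach spaces are over $\mathbb{C}$. For a Banach space $X$, $X^*$ is its dual, $\mathcal{B}(X)$ is the algebra of bounded linear operators on $X$, and $T^*$ denotes the adjoint of a bounded operator $T$. $\omega_1$ is the first uncountable ordinal; $[0, \omega_1)$ and $[0, \omega_1]$ carry the order topology. A subset $D \subseteq [0, \omega_1)$ is a club subset if it is closed and unbounded in $[0, \omega_1)$. $C([0, \omega_1]; X)$ is the Banach space of continuous functions from $[0, \omega_1]$ to $X$ with the supremum norm, and $$Y_X := \lbrace F \in C([0, \omega_1]; X) : F(\omega_1) = 0 \rbrace,$$ a closed subspace. For $\alpha \in [0, \omega_1]$ and $\psi \in X^*$, $\delta_{\alpha} \otimes \psi$ denotes the bounded linear functional $u \mapsto \langle u(\alpha), \psi \rangle$ on $C([0, \omega_1]; X)$;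 its restriction to $Y_X$ is denoted by the same symbol. *)

(* Defs.v *)
From HB Require Import structures.
From mathcomp Require Import all_boot all_order all_algebra.
From mathcomp Require Import all_classical all_reals all_analysis.
From mathcomp Require Import wochoice.
From mathcomp.real_closed Require Import complex.

Set Implicit Arguments.
Unset Strict Implicit.
Unset Printing Implicit Defensive.
Import Order.TTheory GRing.Theory Num.Theory.
Import numFieldNormedType.Exports.
Local Open Scope classical_set_scope.
Local Open Scope complex_scope.
Local Open Scope ring_scope.

Fact ordinal_display : Order.disp_t. Proof. by []. Qed.

Section Omega1.

Definition wo_sets : rel (set nat) := sval (well_ordering_principle (set nat)).

Lemma wo_setsP : well_order wo_sets.
Proof. exact: svalP (well_ordering_principle (set nat)). Qed.

Let wo_chainT : wo_chain wo_sets predT.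
Proof. by move=> A _; exact: wo_setsP. Qed.

Lemma wo_sets_refl : reflexive wo_sets.
Proof. by move=> x; exact: (wo_chain_reflexive wo_chainT). Qed.

Lemma wo_sets_anti : antisymmetric wo_sets.
Proof. by move=> x y; exact: (wo_chain_antisymmetric wo_chainT). Qed.

Lemma wo_sets_total : total wo_sets.
Proof. by move=> x y; exact: (wo_chainW wo_chainT). Qed.

Lemma wo_sets_trans : transitive wo_sets.
Proof.
move=> y x z xy yz.
have [|m [[+ mle] _]] := wo_setsP (A := [pred t | (t == x) || (t == y) || (t == z)]).
  by exists x; rewrite inE eqxx.
have [mx my mz] : [/\ wo_sets m x, wo_sets m y & wo_sets m z].
  by split; apply: mle; rewrite inE eqxx ?orbT.
rewrite inE => /orP[/orP[]|] /eqP E; rewrite {}E in mx my mz.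
- by [].
- suff -> : x = y by [].
  by apply: wo_sets_anti; rewrite xy mx.
- suff E : y = z by move: xy; rewrite E.
  by apply: wo_sets_anti; rewrite yz my.
Qed.

(* [0, omega_1) is the set of points having countably many predecessors in a
   well-ordering of the uncountable set (set nat). This is an initial segment;
   omega1_wf, omega1_lt_countable and omega1_uncountable characterize its order
   type as that of the first uncountable ordinal. *)
Definition omega1_pred (x : set nat) : bool :=
  `[< countable [set y | wo_sets y x && (y != x)] >].

Record omega1 := Omega1 { omega1_val : set nat; _ : omega1_pred omega1_val }.

HB.instance Definition _ := [isSub for omega1_val].
HB.instance Definition _ := [Choice of omega1 by <:].

Definition omega1_le (x y : omega1) :=
  wo_sets (omega1_val x) (omega1_val y).

Let le_anti : antisymmetric omega1_le.
Proof. by move=> x y h; apply/val_inj/wo_sets_anti. Qed.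

Let le_trans : transitive omega1_le.
Proof. by move=> y x z; exact: wo_sets_trans. Qed.

Let le_total : total omega1_le.
Proof. by move=> x y; exact: wo_sets_total. Qed.

HB.instance Definition _ := Order.isOrder.Build ordinal_display omega1
  (fun _ _ => erefl) (fun _ _ => erefl) (fun _ _ => erefl)
  le_anti le_trans le_total.

HB.instance Definition _ := OrderTopological.copy omega1 (order_topology omega1).

Lemma omega1_wf (A : set omega1) : A !=set0 ->
  exists2 m, A m & forall x, A x -> (m <= x)%O.
Proof.
move=> [a Aa].
have [|m [[]]] := wo_setsP (A := mem (omega1_val @` A)).
  by exists (omega1_val a); rewrite inE; exists a.
rewrite inE => -[x Ax <-] mle _; exists x => // y Ay.
by apply: mle; rewrite inE; exists y.
Qed.

Lemma omega1_lt_countable (a : omega1) : countable [set x | (x < a)%O].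
Proof.
have /asboolP := valP a; apply: sub_countable.
apply: (@card_le_trans _ _ _ (omega1_val @` [set x | (x < a)%O])).
  have := inj_card_eq (A := [set x | (x < a)%O]) (in2W val_inj).
  by rewrite card_eq_le => /andP[].
apply: subset_card_le => _ [x xa <-] /=.
by move: xa; rewrite /= lt_neqAle andbC.
Qed.

Lemma omega1_uncountable : ~ countable [set: omega1].
Proof.
move=> cT; set I := range omega1_val.
have cI : countable I by apply: sub_countable cT; exact: card_image_le.
have nI : exists x, x \in mem (~` I).
  apply: contrapT => /forallNP hI.
  have IT t : I t.
    by apply: contrapT => It; apply: (hI t); rewrite inE.
  have /countable_injP[f fI] := cI.
  pose D := [set n | exists2 t, f t = n & ~ t n].
  have E : D (f D) <-> ~ D (f D).
    split=> [[t /fI]|nD]; last by exists D.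
    by rewrite !inE => /(_ (IT _) (IT _)) ->.
  by have nD : ~ D (f D) by [move=> h; exact: (E.1 h)|]; exact: (nD (E.2 nD)).
have [m [[]]] := wo_setsP nI.
rewrite inE => mI mle _; apply: mI.
have Pm : omega1_pred m.
  apply/asboolP; apply: sub_countable cI; apply: subset_card_le => t /andP[tm ntm].
  apply: contrapT => It; move/eqP: ntm; apply; apply: wo_sets_anti.
  by rewrite tm mle// inE.
by exists (Omega1 Pm).
Qed.

End Omega1.

(* [0, omega_1]: the point omega_1 is None, above every Some a. *)
Definition omega1_succ := option omega1.

HB.instance Definition _ := Choice.on omega1_succ.

Section Succ.
Definition omega1_succ_le (x y : omega1_succ) : bool :=
  match x, y with
  | _, None => true
  | None, Some _ => false
  | Some a, Some b => (a <= b)%O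
  end.

Let sle_anti : antisymmetric omega1_succ_le.
Proof. by move=> [a|] [b|] //= /le_anti->. Qed.

Let sle_trans : transitive omega1_succ_le.
Proof. by move=> [b|] [a|] [c|] //=; exact: le_trans. Qed.

Let sle_total : total omega1_succ_le.
Proof. by move=> [a|] [b|] //=; exact: le_total. Qed.

HB.instance Definition _ := Order.isOrder.Build ordinal_display omega1_succ
  (fun _ _ => erefl) (fun _ _ => erefl) (fun _ _ => erefl)
  sle_anti sle_trans sle_total.

HB.instance Definition _ := OrderTopological.copy omega1_succ (order_topology omega1_succ).
End Succ.

Definition omega1_top : omega1_succ := None.
Definition omega1_incl (a : omega1) : omega1_succ := Some a.

Lemma omega1_succ_wf (A : set omega1_succ) : A !=set0 ->
  exists2 m, A m & forall x, A x -> (m <= x)%O.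
Proof.
move=> [a Aa]; have [[b Ab]|A0] := pselect ((Some @^-1` A) !=set0).
  have [|m Am mle] := @omega1_wf (Some @^-1` A); first by exists b.
  by exists (Some m) => // -[x|] // Ax; exact: mle.
by exists a => // -[x|] Ax; [case: A0; exists x|case: a Aa].
Qed.

Section SupNorm.
Context {R : realType} {I : Type} {V : normedModType R[i]}.
Implicit Types (A : set I) (f g : I -> V).

(* Norms take values in R[i], in its nonnegative reals. The supremum is only
   meaningful when f is bounded on the nonempty set A, as in each use below. *)
Definition sup_norm A f : R[i] := (sup [set complex.Re `|f i| | i in A])%:C.

Let normRe (v : V) : `|v| = (complex.Re `|v|)%:C.
Proof. by rewrite RRe_real// ger0_real. Qed.

Lemma sup_norm_ub A f (M : R[i]) : (forall i, A i -> `|f i| <= M) ->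
  forall i, A i -> `|f i| <= sup_norm A f.
Proof.
move=> fM i Ai; rewrite normRe lecR; apply: ub_le_sup; last by exists i.
exists (complex.Re M) => _ [j Aj <-].
by have := fM j Aj; rewrite lecE => /andP[].
Qed.

Lemma sup_norm_le A f (M : R[i]) : A !=set0 ->
  (forall i, A i -> `|f i| <= M) -> sup_norm A f <= M.
Proof.
move=> [i0 Ai0] fM; have M0 : 0 <= M by rewrite (le_trans _ (fM i0 Ai0)).
rewrite -[M]RRe_real ?ger0_real// lecR; apply: ge_sup.
  by exists (complex.Re `|f i0|), i0.
move=> _ [j Aj <-].
by have := fM j Aj; rewrite lecE => /andP[].
Qed.

Definition bounded_on A f := exists M : R[i], forall i, A i -> `|f i| <= M.

Lemma sup_normD A f g : A !=set0 -> bounded_on A f -> bounded_on A g ->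
  sup_norm A (f \+ g) <= sup_norm A f + sup_norm A g.
Proof.
move=> A0 [M fM] [N gN]; apply: sup_norm_le => // i Ai.
by rewrite (le_trans (ler_normD _ _))// lerD// (sup_norm_ub fM, sup_norm_ub gN).
Qed.

Lemma sup_normZ A f (l : R[i]) : A !=set0 -> bounded_on A f ->
  sup_norm A (fun i => l *: f i) = `|l| * sup_norm A f.
Proof.
move=> A0 [M fM].
have lM : forall i, A i -> `|l *: f i| <= `|l| * M.
  by move=> i Ai; rewrite normrZ ler_wpM2l// fM.
apply/le_anti/andP; split.
  apply: sup_norm_le => // i Ai; rewrite normrZ ler_wpM2l//.
  exact: sup_norm_ub fM _ Ai.
have [->|l0] := eqVneq l 0.
  rewrite normr0 mul0r; case: (A0) => i Ai.
  by rewrite (le_trans _ (sup_norm_ub (M := 0) _ Ai))// => j _; rewrite scale0r normr0.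
rewrite mulrC -ler_pdivlMr ?normr_gt0//; apply: sup_norm_le => // i Ai.
rewrite ler_pdivlMr ?normr_gt0// mulrC -normrZ.
exact: (sup_norm_ub lM).
Qed.

Lemma sup_norm0_eq0 A f : bounded_on A f -> sup_norm A f = 0 ->
  forall i, A i -> f i = 0.
Proof.
move=> [M fM] f0 i Ai; apply/eqP; rewrite -normr_le0 -f0.
exact: (sup_norm_ub fM).
Qed.

End SupNorm.

Section BoundedOperator.
Context {R : realType}.
Variables (V W : normedModType R[i]).

Definition bop_pred : {pred V -> W} := mem [set f | linear f /\
  exists M : R[i], forall x, `|f x| <= M * `|x|].

Record bop := Bop { bop_fun :> V -> W; _ : bop_fun \in bop_pred }.

HB.instance Definition _ := [isSub for bop_fun].
HB.instance Definition _ := [Choice of bop by <:].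

Lemma bop_linear (T : bop) : linear T.
Proof. by have := valP T; rewrite inE => -[]. Qed.

Lemma bop_bounded (T : bop) : exists M : R[i], forall x, `|T x| <= M * `|x|.
Proof. by have := valP T; rewrite inE => -[]. Qed.

HB.instance Definition _ (T : bop) :=
  GRing.isLinear.Build R[i] V W _ (bop_fun T) (@bop_linear T).

Lemma bop_submod_closed : submod_closed bop_pred.
Proof.
split.
  rewrite inE/=; split; first by move=> a x y; rewrite /= scaler0 addr0.
  by exists 0 => x; rewrite mul0r normr0.
move=> a f g; rewrite !inE => -[lf [M fM]] [lg [N gN]]; split.
  move=> b x y; rewrite -[LHS]/(a *: f (b *: x + y) + g (b *: x + y)) lf lg.
  rewrite -[RHS]/(b *: (a *: f x + g x) + (a *: f y + g y)) !scalerDr !scalerA.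
  by rewrite [b * a]mulrC addrACA.
exists (`|a| * M + N) => x; rewrite (le_trans (ler_normD _ _))//.
by rewrite mulrDl lerD// normrZ -mulrA ler_wpM2l.
Qed.

HB.instance Definition _ := GRing.isSubmodClosed.Build _ _ bop_pred bop_submod_closed.
HB.instance Definition _ := [SubChoice_isSubLmodule of bop by <:].

Definition op_norm (T : bop) : R[i] := sup_norm [set x : V | `|x| <= 1] T.

Let unit_ball0 : [set x : V | `|x| <= 1] !=set0.
Proof. by exists 0; rewrite /= normr0. Qed.

Let bop_bounded_on (T : bop) : bounded_on [set x : V | `|x| <= 1] T.
Proof.
have [M TM] := bop_bounded T; exists (`|M| * 1) => x /= x1.
rewrite (le_trans (TM x))//.
have [->|x0] := eqVneq x 0; first by rewrite normr0 mulr0 mulr1.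
have M0 : 0 <= M.
  by rewrite -(pmulr_lge0 M (x := `|x|)) ?normr_gt0// (le_trans _ (TM x)).
by rewrite ger0_norm// ler_wpM2l.
Qed.

Let op_normD (S T : bop) : op_norm (S + T) <= op_norm S + op_norm T.
Proof. exact: sup_normD. Qed.

Let op_normZ (l : R[i]) (T : bop) : op_norm (l *: T) = `|l| * op_norm T.
Proof. exact: sup_normZ. Qed.

Let op_norm0_eq0 (T : bop) : op_norm T = 0 -> T = 0.
Proof.
move=> T0; apply/val_inj/funext => x /=.
have [->|x0] := eqVneq x 0; first by rewrite linear0.
have /eqP : T (`|x|^-1 *: x) = 0.
  apply: (sup_norm0_eq0 (bop_bounded_on T) T0) => /=.
  by rewrite normrZ normfV normr_id mulVf// normr_eq0.
by rewrite linearZ/= scaler_eq0 invr_eq0 normr_eq0 (negPf x0) => /eqP.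
Qed.

HB.instance Definition _ := Lmodule_isNormed.Build R[i] bop
  op_normD op_normZ op_norm0_eq0.

Lemma bop_normE (T : bop) : `|T| = op_norm T.
Proof. by []. Qed.

Lemma bop_norm_le (T : bop) x : `|T x| <= `|T| * `|x|.
Proof.
have [->|x0] := eqVneq x 0; first by rewrite linear0 !normr0 mulr0.
have [M TM] := bop_bounded_on T.
have := sup_norm_ub TM (i := `|x|^-1 *: x).
rewrite /= !linearZ/= !normrZ normfV normr_id mulVf ?normr_eq0// => /(_ (lexx _)).
by rewrite mulrC ler_pdivrMr ?normr_gt0.
Qed.

End BoundedOperator.

Section Duality.
Context {R : realType}.

Section Comp.
Context {U V W : normedModType R[i]}.

Let comp_subproof (S : bop V W) (T : bop U V) : S \o T \in @bop_pred R U W.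
Proof.
rewrite inE; split; first by move=> a x y; rewrite /= !linearP.
exists (`|S| * `|T|) => x /=; rewrite (le_trans (bop_norm_le _ _))// -mulrA.
by rewrite ler_wpM2l// bop_norm_le.
Qed.

(* The product of the algebra B(V) is bop_comp with U = V = W. *)
Definition bop_comp (S : bop V W) (T : bop U V) : bop U W :=
  Bop (comp_subproof S T).
End Comp.

Definition dual_space (V : normedModType R[i]) := bop V R[i]^o.

HB.instance Definition _ V := NormedModule.on (dual_space V).

Definition adjoint (V W : normedModType R[i]) (T : bop V W) (psi : dual_space W) :
  dual_space V := bop_comp psi T.

Section Bidual.
Context {V : normedModType R[i]}.

Let bidual_eval_subproof (x : V) :
  (fun psi : dual_space V => psi x : R[i]^o) \in @bop_pred R (dual_space V) R[i]^o.
Proof.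
rewrite inE; split; first by [].
by exists `|x| => psi; rewrite mulrC; exact: bop_norm_le.
Qed.

Definition bidual_eval (x : V) : dual_space (dual_space V) := Bop (bidual_eval_subproof x).
End Bidual.

Definition reflexive_space (V : normedModType R[i]) :=
  forall Phi : dual_space (dual_space V), exists x : V, bidual_eval x = Phi.

End Duality.

Definition separable_space (T : topologicalType) :=
  exists2 A : set T, countable A & dense A.

Definition club (D : set omega1) :=
  closed D /\ forall a, exists2 b, D b & (a < b)%O.

Section YX.
Context {R : realType}.
Variable X : normedModType R[i].

Lemma continuous_omega1_succ_bounded (F : omega1_succ -> X) :
  continuous F -> bounded_on setT F.
Proof.
move=> cF; pose P a := exists M : R[i], forall b, (b <= a)%O -> `|F b| <= M.
suff [M FM] : P None by exists M => i _; apply: FM; case: i.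
apply: contrapT => nP.
have [|a nPa mle] := @omega1_succ_wf (~` P); first by exists None.
apply: nPa.
have := cF a; move/cvgrPdist_lt => /(_ 1 ltr01).
rewrite /= itv_nbhsE => -[[l r] [+ ai] ib].
have Fb b : (l <= BLeft b)%O -> (b <= a)%O -> `|F b| <= `|F a| + 1.
  move=> lb ba.
  have /ib /= /ltW : b \in Interval l r.
    rewrite itv_boundlr lb/=; move: ai; rewrite itv_boundlr => /andP[_].
    by apply: le_trans; rewrite bnd_simp.
  rewrite distrC => Fba; rewrite -{1}[F b](subrK (F a)).
  by rewrite (le_trans (ler_normD _ _))// addrC lerD2l.
case: l ai Fb {ib} => [c x|[]].
- move=> ai Fb oe; have cE := itv_open_ends_lside oe; rewrite {}cE in ai Fb oe *.
  have xa : (x < a)%O.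
    move: ai; rewrite itv_boundlr => /andP[+ _].
    by rewrite bnd_simp.
  have [M FM] : P x.
    by apply: contrapT => nPx; have := mle _ nPx; rewrite leNgt xa.
  exists (M + (`|F a| + 1)) => b ba.
  have M0 : 0 <= M by rewrite (le_trans _ (FM x _)).
  have [bx|xb] := leP b x.
    by rewrite (le_trans (FM _ bx))// lerDl addr_ge0.
  by rewrite (le_trans (Fb b _ ba)) ?lerDr// bnd_simp.
- by move=> ai Fb _; exists (`|F a| + 1) => b; exact: Fb.
- by rewrite itv_boundlr => /andP[].
Qed.

(* Y_X is defined directly as a space of functions on [0, omega_1], with the
   supremum norm it inherits from C([0, omega_1]; X). *)
Definition YX_pred : {pred omega1_succ -> X} :=
  mem [set F : omega1_succ -> X | continuous F /\ F omega1_top = 0].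

Record YX := MkYX { YX_fun :> omega1_succ -> X; _ : YX_fun \in YX_pred }.

HB.instance Definition _ := [isSub for YX_fun].
HB.instance Definition _ := [Choice of YX by <:].

Lemma YX_continuous (F : YX) : continuous F.
Proof. by have := valP F; rewrite inE => -[]. Qed.

Lemma YX_top (F : YX) : F omega1_top = 0.
Proof. by have := valP F; rewrite inE => -[]. Qed.

Lemma YX_submod_closed : submod_closed YX_pred.
Proof.
split; first by rewrite inE; split => //; exact: (@cst_continuous omega1_succ X 0).
move=> a F G; rewrite !inE => -[cF F0] [cG G0]; split.
  by move=> x; exact: (cvgD (cvgZl_tmp (k := a) (cF x)) (cG x)).
by rewrite -[LHS]/(a *: F omega1_top + G omega1_top) F0 G0 scaler0 addr0.
Qed.

HB.instance Definition _ := GRing.isSubmodClosed.Build _ _ YX_pred YX_submod_closed.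
HB.instance Definition _ := [SubChoice_isSubLmodule of YX by <:].

Definition YX_norm (F : YX) : R[i] := sup_norm setT F.

Let YX_bounded_on (F : YX) : bounded_on setT F.
Proof. exact/continuous_omega1_succ_bounded/YX_continuous. Qed.

Let YX_normD (F G : YX) : YX_norm (F + G) <= YX_norm F + YX_norm G.
Proof. by apply: sup_normD => //; exists None. Qed.

Let YX_normZ (l : R[i]) (F : YX) : YX_norm (l *: F) = `|l| * YX_norm F.
Proof. by apply: sup_normZ => //; exists None. Qed.

Let YX_norm0_eq0 (F : YX) : YX_norm F = 0 -> F = 0.
Proof.
move=> F0; apply/val_inj/funext => a /=.
exact: (sup_norm0_eq0 (YX_bounded_on F) F0).
Qed.

HB.instance Definition _ := Lmodule_isNormed.Build R[i] YX
  YX_normD YX_normZ YX_norm0_eq0.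

Lemma YX_norm_ub (F : YX) a : `|F a| <= `|F|.
Proof. by have [M FM] := YX_bounded_on F; exact: (sup_norm_ub FM). Qed.

Let delta_subproof (a : omega1_succ) (psi : dual_space X) :
  (fun F : YX => psi (F a) : R[i]^o) \in @bop_pred R YX R[i]^o.
Proof.
rewrite inE; split.
  by move=> k F G; rewrite -[RHS]linearP.
exists `|psi| => F; rewrite (le_trans (bop_norm_le _ _))// ler_wpM2l//.
exact: YX_norm_ub.
Qed.

Definition delta_tensor (a : omega1_succ) (psi : dual_space X) : dual_space YX :=
  Bop (delta_subproof a psi).

End YX.

(* Linearity and boundedness are part of the type of Phi. The condition that Phi
   preserve the identity operator is not imposed. *)
Definition algebra_hom {R : realType} {V W : normedModType R[i]}
    (Phi : bop (bop V V) (bop W W)) :=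
  forall S T : bop V V, Phi (bop_comp S T) = bop_comp (Phi S) (Phi T).

(* Main.v *)
Require Import Defs.
From HB Require Import structures.
From mathcomp Require Import all_boot all_order all_algebra.
From mathcomp Require Import all_classical all_reals all_analysis.
From mathcomp.real_closed Require Import complex.
From mathcomp Require Import ring.

Set Implicit Arguments.
Unset Strict Implicit.
Unset Printing Implicit Defensive.
Import Order.TTheory GRing.Theory Num.Theory.
Import numFieldNormedType.Exports.
Local Open Scope classical_set_scope.
Local Open Scope complex_scope.
Local Open Scope ring_scope.

(** Write [step a x] for the function 1_[0, a] (x) x in Y_X. The pairing of both
    sides of the defining identity with F in Y_X, for all psi, says that
    S F a = T (F a); this is the relation [represents S T], required for a in a
    club ([representsP]; Hahn-Banach is used to cancel psi). Two clubs intersect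
    in a club ([clubI]), so T is unique, and the assignment of T to S respects
    sums, scalars and products.

    For the existence of T, steps have dense span in Y_X ([step_total]), so only
    the values S (step b x) a matter. Three facts about them are used.

    - For fixed b, they vanish for all large a, since a continuous function on
      [0, omega_1] with value 0 at omega_1 is 0 near omega_1
      ([step_image_eventually0]).
    - For fixed a, they do not depend on b for large b. For a scalar functional
      phi in place of S (.) a, the function b |-> phi (step b x) has bounded
      variation ([step_small_jump]), hence is eventually constant; countably many
      functionals separate the points of the separable space X
      ([operator_step_eventually_cst]).
    - By separability the thresholds in both facts can be chosen uniformly in x,
      as h b and h a. Let D0 be a club of nonzero a closed under h. For a in D0,
      the values at a vanish for b < a; for b >= a they equal S (step a x) a, by
      taking the limit, from the left at a, of the second fact.

    Thus S F a = T_a (F a) for a in D0, where T_a x = S (step a x) a. If a increases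
    in D0 to l, then T_a x = S (step l x) a for those a, which converges; so
    a |-> T_a x has no infinite sequence of large jumps and is eventually constant
    on D0 ([eventually_cst]), again uniformly in x. Its final value T gives
    the theorem ([represented]), with |T| <= |S|.

    Finally T \o - on Y_X represents T, which provides the right inverse Lambda,
    and F |-> step a (F a) is a nonzero operator represented by 0. *)

(** * Countable subsets, the order topology and clubs of [0, omega_1) *)

Lemma countableU1 {T} (x : T) (A : set T) : countable A -> countable (x |` A).
Proof.
move=> cA; rewrite -bigcup2E; apply: bigcup_countable => // -[|[|n]] _ //=.
Qed.

Lemma omega1_countable_lt (A : set omega1) : countable A ->
  exists b, forall a, A a -> (a < b)%O.
Proof.
move=> cA; apply: contrapT => nA; apply: omega1_uncountable.
apply: (@sub_countable _ _ _ (\bigcup_(a in A) ([set a] `|` [set x | (x < a)%O]))).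
  apply: subset_card_le => b _.
  apply: contrapT => nb; apply: nA; exists b => a Aa.
  rewrite ltNge le_eqVlt; apply/negP => /orP[/eqP ba|ba]; apply: nb; exists a => //.
  - by left.
  - by right.
by apply: bigcup_countable => // a _; apply: countableU1; exact: omega1_lt_countable.
Qed.

Lemma omega1_nonempty : [set: omega1] !=set0.
Proof. by have [a _] := omega1_countable_lt (@countable0 omega1); exists a. Qed.

Lemma omega1_gt (a : omega1) : exists b, (a < b)%O.
Proof.
by have [b ab] := omega1_countable_lt (countable1 a); exists b; exact: ab.
Qed.

Lemma omega1_succ_elem (a : omega1) : exists s, forall x : omega1, (x < s)%O = (x <= a)%O.
Proof.
have [s as_ smin] := @omega1_wf [set x | (a < x)%O] (omega1_gt a).
exists s => x; apply/idP/idP => [xs|/le_lt_trans]; last exact.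
by rewrite leNgt; apply/negP => /smin; rewrite leNgt xs.
Qed.

Lemma omega1_seq_lub (a : nat -> omega1) : (forall n, (a n < a n.+1)%O) ->
  exists l, (forall n, (a n < l)%O) /\
            forall b, (b < l)%O -> exists n, (b < a n)%O.
Proof.
move=> amon.
have cA : countable (range a) by apply: sub_countable (card_image_le _ _) _.
have [b ab] := omega1_countable_lt cA.
have [|l la lmin] := @omega1_wf [set l | forall n, (a n < l)%O].
  by exists b => n; apply: ab; exists n.
exists l; split=> // c cl; apply: contrapT => /forallNP nc.
have : (l <= c)%O.
  apply: lmin => n /=; rewrite (lt_le_trans (amon n))// leNgt.
  by apply/negP; exact: nc.
by rewrite leNgt cl.
Qed.

(** Countably many thresholds in [0, omega_1) have a common bound; this is how
    conditions indexed by a countable dense subset of X are met at once. *)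
Lemma countable_eventually T (A : set T) (P : T -> set omega1) : countable A ->
  (forall x, A x -> exists c, forall b, (c < b)%O -> P x b) ->
  exists c, forall b, (c < b)%O -> forall x, A x -> P x b.
Proof.
move=> cA evP.
have /choice[c cP] : forall x, exists c, A x -> forall b, (c < b)%O -> P x b.
  move=> x; have [Ax|nAx] := pselect (A x); first by have [c] := evP x Ax; exists c.
  by have [c _] := omega1_nonempty; exists c.
have cc : countable (c @` A) by apply: sub_countable (card_image_le _ _) _.
have [d cd] := omega1_countable_lt cc.
exists d => b db x Ax; apply: cP => //; apply: lt_trans db; apply: cd.
by exists x.
Qed.

(** A left neighbourhood of l contains an interval (b, l]; the point b0 only ensures
    that l is not the least element. *)
Lemma nbhs_left_interval {d} {T : orderTopologicalType d} (b0 l : T) (B : set T) :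
  (b0 < l)%O -> nbhs l B ->
  exists2 b, (b < l)%O & forall c, (b < c)%O -> (c <= l)%O -> B c.
Proof.
move=> b0l; rewrite itv_nbhsE => -[[i j] [oij lij] ijB].
have {}ijB c : (i <= BLeft c)%O -> (c <= l)%O -> B c.
  move=> ic cl; apply: ijB => /=; rewrite itv_boundlr ic/=.
  move: lij; rewrite /= itv_boundlr => /andP[_]; apply: le_trans.
  by rewrite bnd_simp.
case: i oij lij ijB => [c x|[]] oij lij ijB.
- have cE := itv_open_ends_lside oij; rewrite {}cE in lij ijB *.
  exists x; first by move: lij; rewrite /= itv_boundlr => /andP[+ _]; rewrite bnd_simp.
  by move=> c' xc' c'l; apply: ijB => //; rewrite bnd_simp.
- by exists b0 => // c' _; exact: ijB.
- by move: lij; rewrite /= itv_boundlr => /andP[].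
Qed.

Lemma omega1_closed_ge (a : omega1) : closed [set x | (a <= x)%O].
Proof. by rewrite -[X in closed X]set_itvE; exact: rray_closed. Qed.

Lemma omega1_closed_gt (a : omega1) : closed [set x | (a < x)%O].
Proof.
have [s sE] := omega1_succ_elem a.
rewrite [X in closed X](_ : _ = [set x | (s <= x)%O]); first exact: omega1_closed_ge.
by apply/seteqP; split => x /=; rewrite leNgt sE -ltNge.
Qed.

Lemma omega1_closed_le (a : omega1) : closed [set x | (x <= a)%O].
Proof. by rewrite -[X in closed X]set_itvE; exact: lray_closed. Qed.

(** The ordinals closed under h form a club: closing any ordinal under h takes
    omega steps, and a countable supremum stays below omega_1. *)
Lemma club_closed_under (h : omega1 -> omega1) :
  club [set a | forall b, (b < a)%O -> (h b < a)%O].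
Proof.
split.
  rewrite (_ : mkset _ = \bigcap_b ([set a | (a <= b)%O] `|` [set a | (h b < a)%O])).
    apply: closed_bigI => b _; apply: closedU.
      exact: omega1_closed_le.
    exact: omega1_closed_gt.
  apply/seteqP; split => a ha b /=; last first.
    by move=> ba; have [|//] := ha b I; rewrite /= leNgt ba.
  by move=> _; have [ab|ba] := leP a b; [left|right; exact: ha].
move=> a0.
have next a : exists b, (a < b)%O /\ forall c, (c <= a)%O -> (h c < b)%O.
  have cB : countable (a |` (h @` (a |` [set x | (x < a)%O]))).
    apply: countableU1; apply: sub_countable (card_image_le _ _) _.
    by apply: countableU1; exact: omega1_lt_countable.
  have [b bP] := omega1_countable_lt cB; exists b; split; first by apply: bP; left.
  move=> c; rewrite le_eqVlt => ca; apply: bP; right; exists c => //.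
  by case/orP: ca => [/eqP|]; [left|right].
have [f fP] := choice next.
pose u n := iter n f a0.
have umon n : (u n < u n.+1)%O by have [] := fP (u n).
have [l [ul lu]] := omega1_seq_lub umon.
exists l; last exact: (ul 0%N).
move=> b /= /lu[n bn]; apply: (lt_trans _ (ul n.+1)).
by have [_] := fP (u n); apply; exact: ltW.
Qed.

Lemma club_ge (a : omega1) : club [set x | (a <= x)%O].
Proof.
split; first exact: omega1_closed_ge.
move=> b; have [c bc] := omega1_gt (Order.max a b).
by exists c; [rewrite /= ltW// (le_lt_trans _ bc)// le_max lexx
             |rewrite (le_lt_trans _ bc)// le_max lexx orbT].
Qed.

(** Between consecutive steps of a suitable function h one meets both clubs, so
    an ordinal closed under h is a limit of points of each. *)
Lemma clubI (C D : set omega1) : club C -> club D -> club (C `&` D).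
Proof.
move=> [cC uC] [cD uD]; split; first exact: closedI.
have /choice[f fP] : forall a, exists b, C b /\ (a < b)%O.
  by move=> a; have [b] := uC a; exists b.
have /choice[g gP] : forall a, exists b, D b /\ (a < b)%O.
  by move=> a; have [b] := uD a; exists b.
have lim (E : set omega1) (k : omega1 -> omega1) l : closed E ->
    (forall b, E (k b) /\ (b < k b)%O) -> (exists b, (b < l)%O) ->
    (forall b, (b < l)%O -> (k b < l)%O) -> E l.
  move=> cE kP [b0 b0l] kl; apply: cE => B /(nbhs_left_interval b0l)[b bl bB].
  have [Ek bk] := kP b; exists (k b); split=> //; apply: bB => //.
  exact/ltW/kl.
move=> a; have [_ uE] := club_closed_under (fun b => Order.max (f b) (g b)).
have [l hl al] := uE a; exists l => //; split.
- apply: (lim _ f) => //; first by exists a.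
  by move=> b /hl; rewrite gt_max => /andP[].
- apply: (lim _ g) => //; first by exists a.
  by move=> b /hl; rewrite gt_max => /andP[].
Qed.

(** * The Hahn-Banach theorem over the complex numbers *)

Section HahnBanach.
Context {R : realType}.

(** Positive homogeneity is required as an inequality only, for scalars t > 0: applied
    to t and to its inverse, it gives the equality, and then p 0 = 0. *)
Definition sublinear (V : lmodType R[i]) (p : V -> R) :=
  (forall x y, p (x + y) <= p x + p y) /\
  (forall (t : R) x, 0 < t -> p (t%:C *: x) <= t * p x).

Section Sublinear.
Context {V : lmodType R[i]}.
Implicit Types (p q u : V -> R).

Lemma sublinearZ p t x : sublinear p -> 0 < t -> p (t%:C *: x) = t * p x.
Proof.
move=> [_ ph] t0; apply/le_anti/andP; split; first exact: ph.
have ti0 : 0 < t^-1 by rewrite invr_gt0.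
have := ph t^-1 (t%:C *: x) ti0; rewrite scalerA -rmorphM/= mulVf ?gt_eqF//.
by rewrite rmorph1 scale1r ler_pdivlMl.
Qed.

Lemma sublinear0 p : sublinear p -> p 0 = 0.
Proof.
move=> ps; have := sublinearZ 0 ps (ltr0Sn _ 1); rewrite scaler0.
by rewrite mulr_natl mulr2n => /eqP;
  rewrite -subr_eq0 opprD addrA subrr sub0r oppr_eq0 => /eqP.
Qed.

Lemma sublinear_opp_ge p x : sublinear p -> - p (- x) <= p x.
Proof.
move=> ps; have [pD _] := ps; have := pD x (- x).
by rewrite subrr sublinear0// -lerBlDr sub0r.
Qed.

(** The slope of p in the direction y, seen from far away, is p y itself; hence
    subtracting t * p y from p (x + t y) and letting t vary gives a sublinear
    functional below p that is additive in the direction y. *)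
Lemma sublinear_tilt p y : sublinear p -> exists q, [/\ sublinear q,
  forall x, q x <= p x & forall x, q x <= p (x + y) - p y].
Proof.
move=> ps; have [pD pZ] := ps.
pose f x t := p (x + t%:C *: y) - t * p y.
pose q x := inf [set f x t | t in [set t | 0 <= t]].
have fE t x : 0 <= t -> q x <= f x t.
  move=> t0; apply: ge_inf; last by exists t.
  exists (- p (- x)) => _ [s /= s0 <-]; rewrite /f lerBrDr.
  have -> : s * p y = p (s%:C *: y).
    move: s0; rewrite le_eqVlt => /orP[/eqP<-|s0]; last by rewrite sublinearZ.
    by rewrite mul0r rmorph0 scale0r sublinear0.
  by rewrite addrC lerBlDr (le_trans _ (pD _ _))// addrAC subrr add0r.
have q_ge x c : (forall t : R, 0 <= t -> c <= f x t) -> c <= q x.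
  move=> cf; apply: lb_le_inf; first by exists (f x 0), 0; rewrite /= ?lexx.
  by move=> _ [t t0 <-]; exact: cf.
exists q; split.
- split=> [x z|t x t0].
    rewrite -lerBlDr; apply: (q_ge) => t t0; rewrite lerBlDr -lerBlDl.
    apply: (q_ge) => s s0; rewrite lerBlDl.
    apply: le_trans (fE (t + s) _ _) _; first exact: addr_ge0.
    rewrite /f rmorphD/= scalerDl addrACA mulrDl opprD [leRHS]addrACA.
    by rewrite lerD2r pD.
  rewrite -ler_pdivrMl//; apply: (q_ge) => s s0; rewrite ler_pdivrMl//.
  apply: le_trans (fE (t * s) _ _) _; first by rewrite mulr_ge0// ltW.
  rewrite /f rmorphM/= -scalerA -scalerDr sublinearZ//.
  by rewrite mulrBr mulrA.
- by move=> x; have := fE 0 x (lexx _); rewrite /f rmorph0 scale0r addr0 mul0r subr0.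
- by move=> x; have := fE 1 x ler01; rewrite /f rmorph1 scale1r mul1r.
Qed.

(** The infimum of a chain of sublinear functionals below p is finite, because
    q x >= - p (- x) for all of them, so Zorn's lemma applies. *)
Lemma minimal_sublinear p : sublinear p -> exists q, [/\ sublinear q,
  forall x, q x <= p x &
  forall r, sublinear r -> (forall x, r x <= q x) -> r = q].
Proof.
move=> ps; pose T := {q : V -> R | sublinear q /\ forall x, q x <= p x}.
pose leT : rel T := fun (q r : T) => `[< forall x, sval r x <= sval q x >].
have [||||m mmin] := @Zorn T leT.
- by move=> q; apply/asboolP.
- move=> q r s /asboolP qr /asboolP rs; apply/asboolP => x.
  exact: le_trans (rs x) (qr x).
- move=> q r /asboolP qr /asboolP rq; apply: eq_sig_hprop => [? ? ?|].
    exact: Prop_irrelevance.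
  by apply/funext => x; apply/le_anti; rewrite qr rq.
- move=> A totA; have [[q0 Aq0]|A0] := pselect (A !=set0); last first.
    by exists (exist _ p (conj ps (fun x => lexx (p x)))) => s As; case: A0; exists s.
  pose m x := inf ((fun q : T => sval q x) @` A).
  have mE (q : T) x : A q -> m x <= sval q x.
    move=> Aq; apply: ge_inf; last by exists q.
    exists (- p (- x)) => _ [r Ar <-]; have [rs rp] := svalP r.
    by apply: le_trans (sublinear_opp_ge x rs); rewrite lerN2.
  have m_ge x c : (forall q : T, A q -> c <= sval q x) -> c <= m x.
    move=> cA; apply: lb_le_inf; first by exists (sval q0 x), q0.
    by move=> _ [q Aq <-]; exact: cA.
  have ms : sublinear m.
    split=> [x y|t x t0].
      rewrite -lerBlDr; apply: (m_ge) => q Aq; rewrite lerBlDr -lerBlDl.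
      apply: (m_ge) => r Ar; rewrite lerBlDl.
      have [[qD _] _] := svalP q; have [[rD _] _] := svalP r.
      have [/asboolP qr|/asboolP rq] := totA _ _ Aq Ar.
      - by rewrite (le_trans (mE r _ Ar))// (le_trans (rD _ _))// lerD2r.
      - by rewrite (le_trans (mE q _ Aq))// (le_trans (qD _ _))// lerD2l.
    rewrite -ler_pdivrMl//; apply: (m_ge) => q Aq; rewrite ler_pdivrMl//.
    by have [[_ qZ] _] := svalP q; rewrite (le_trans (mE q _ Aq))// qZ.
  have mp x : m x <= p x.
    by apply: le_trans (mE q0 x Aq0) _; have [_] := svalP q0.
  by exists (exist _ m (conj ms mp)) => q Aq; apply/asboolP => x /=; exact: mE.
have [ms mp] := svalP m; exists (sval m); split => // r rs rm.
have rp x : r x <= p x by exact: le_trans (rm x) (mp x).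
by rewrite -(mmin (exist _ r (conj rs rp)))//; apply/asboolP.
Qed.

(** A minimal sublinear functional q equals all its tilts, so q x + q y <= q (x + y):
    it is linear. Starting from the tilt of p in the direction y, whose value at
    - y is at most - p y, makes it agree with p at y. *)
Lemma hahn_banach_sublinear p y : sublinear p -> exists u,
  [/\ forall x z, u (x + z) = u x + u z,
      forall (t : R) x, u (t%:C *: x) = t * u x,
      forall x, u x <= p x & u y = p y].
Proof.
move=> ps; have [r [rs rp ry]] := sublinear_tilt y ps.
have [u [us ur umin]] := minimal_sublinear rs.
have uD x z : u (x + z) = u x + u z.
  apply/le_anti/andP; split; first by case: us.
  have [q [qs qu qz]] := sublinear_tilt z us.
  by have := qz x; rewrite (umin q qs qu) lerBrDr.
have uN x : u (- x) = - u x.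
  by apply/eqP; rewrite -addr_eq0 addrC -uD subrr sublinear0.
have up x : u x <= p x by exact: le_trans (ur x) (rp x).
exists u; split => // [t x|].
  have [t0|t0|->] := ltrgt0P t.
  - by rewrite sublinearZ.
  - have := sublinearZ x us (t := - t); rewrite oppr_gt0 => /(_ t0).
    by rewrite rmorphN scaleNr uN mulNr => /oppr_inj.
  - by rewrite rmorph0 scale0r mul0r sublinear0.
apply/le_anti; rewrite up/= -lerN2 -uN (le_trans (ur _))// (le_trans (ry _))//.
by rewrite addNr sublinear0// sub0r.
Qed.

End Sublinear.

(** The complex functional is recovered from its real part u as
    x |-> u x - i u (i x), and rotating x to make its value real transfers the
    bound from u. *)
Lemma hahn_banach_norm (V : normedModType R[i]) (y : V) :
  exists psi : dual_space V, (forall x, `|psi x| <= `|x|) /\ `|psi y| = `|y|.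
Proof.
have normE (v : V) : `|v| = (complex.Re `|v|)%:C by rewrite RRe_real// ger0_real.
pose p (x : V) := complex.Re `|x|.
have ps : sublinear p.
  split=> [x z|t x t0]; rewrite -lecR.
    by rewrite rmorphD/= -!normE; exact: ler_normD.
  rewrite rmorphM/= -!normE normrZ ger0_norm//.
  by rewrite ler0c ltW.
have [u [uD uZ up uy]] := hahn_banach_sublinear y ps.
pose f (x : V) : R[i]^o := (u x -i* u ('i%C *: x))%C.
have fl : linear f.
  move=> k x z.
  have scE (w : V) : u (k *: w) = complex.Re k * u w + complex.Im k * u ('i%C *: w).
    by rewrite {1}[k]complexE scalerDl uD uZ ['i%C * _]mulrC -scalerA uZ.
  have uN w : u (- w) = - u w by rewrite -scaleN1r -(rmorphN1 (real_complex R)) uZ mulN1r.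
  have sc2 : u ('i%C *: (k *: x)) = complex.Re k * u ('i%C *: x) - complex.Im k * u x.
    rewrite scalerA mulrC -scalerA scE scalerA -expr2 sqr_i scaleN1r uN.
    by rewrite mulrN.
  rewrite /f scalerDr !uD sc2 scE /=.
  case: k {scE sc2} => a b; rewrite /GRing.scale/=; simpc.
  by congr (_ +i* _)%C; ring.
have fb x : `|f x| <= `|x|.
  have [->|fx0] := eqVneq (f x) 0; first by rewrite normr0.
  have nf0 : `|f x| != 0 by rewrite normr_eq0.
  (* The rotation by c makes f (c *: x) real, hence equal to u (c *: x). *)
  pose c := `|f x| / f x.
  have c1 : `|c| = 1 by rewrite normrM normr_id normfV mulfV.
  have fc : f (c *: x) = `|f x|.
    have := fl c x 0; rewrite addr0.
    have -> : f 0 = 0 by have := fl (-1) 0 0; rewrite scaler0 addr0 scaleN1r addNr.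
    by rewrite addr0 => ->; rewrite /GRing.scale/= /c -mulrA mulVf// mulr1.
  have : u (c *: x) = complex.Re `|f x| by rewrite -fc.
  have := up (c *: x); rewrite /p normrZ c1 mul1r => + uE; rewrite uE -lecR.
  by rewrite -normE RRe_real// ger0_real.
have fB : f \in @bop_pred R V R[i]^o.
  by rewrite inE; split => //; exists 1 => x; rewrite mul1r.
exists (Bop fB); split => //=; apply/le_anti; rewrite fb/=.
by apply: le_trans (normc_ge_Re _); rewrite /= uy ger0_norm -?normE// -ler0c -normE.
Qed.

End HahnBanach.

Section Separable.
Context {R : realType} {V : normedModType R[i]}.

Lemma dense_approx (A : set V) (v : V) (e : R[i]) : dense A -> 0 < e ->
  exists2 a, A a & `|v - a| < e.
Proof.
move=> dA e0; have [||a [va Aa]] := dA (ball v e).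
- by exists v; exact: ballxx.
- exact: ball_open.
- by exists a => //; move: va; rewrite -ball_normE.
Qed.

(** Norming functionals of a dense sequence: if they all vanish at v, then
    a point a of the sequence has norm |psi a| = |psi (a - v)| <= |a - v|. *)
Lemma separable_separating_dual : separable_space V ->
  exists2 Psi : set (dual_space V), countable Psi &
    forall v, (forall psi, Psi psi -> psi v = 0) -> v = 0.
Proof.
move=> [A cA dA]; have [f fP] := choice (@hahn_banach_norm R V).
exists (f @` A); first by apply: sub_countable (card_image_le _ _) _.
move=> v v0; apply/eqP; rewrite -normr_le0; apply/ler_addgt0Pr => e e0.
rewrite add0r; have [a Aa va] := dense_approx v dA (divr_gt0 e0 (ltr0Sn _ 1)).
have [fb fa] := fP a.
have aE : `|a| <= `|v - a|.
  rewrite -fa distrC (le_trans _ (fb _))// linearB/= (v0 (f a)) ?subr0//.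
rewrite -(subrK a v) (splitr e) (le_trans (ler_normD _ _))// lerD ?(ltW va)//.
by rewrite (le_trans aE)// ltW.
Qed.

End Separable.

(** * Eventually constant functions on [0, omega_1) *)

Lemma complex_archi {R : realType} (e : R[i]) : 0 < e ->
  exists n : nat, n.+1%:R^-1 < e.
Proof.
move=> e0; rewrite -[e]RRe_real ?gtr0_real//.
have re0 : 0 < complex.Re e by rewrite -ltcR RRe_real ?gtr0_real.
exists (Num.truncn (complex.Re e)^-1).
rewrite -(rmorph_nat (real_complex R)) -fmorphV ltcR invf_plt ?posrE ?ltr0n//.
exact: truncnS_gt.
Qed.

(** A map into a metric space without infinitely many consecutive jumps of a
    fixed size along increasing sequences is eventually constant: for each n it
    varies by at most 2/n beyond some index, and countably many indices are
    bounded. *)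
Lemma eventually_cst {R : realType} (V : normedModType R[i]) (D : set omega1)
    (f : omega1 -> V) :
  (forall a, exists2 b, D b & (a < b)%O) ->
  (forall u : nat -> omega1, (forall n, D (u n)) ->
     (forall n, (u n < u n.+1)%O) ->
     forall e : R[i], 0 < e -> exists n, `|f (u n) - f (u n.+1)| <= e) ->
  exists c, exists a, forall b, (a < b)%O -> D b -> f b = c.
Proof.
move=> uD fu.
have small (e : R[i]) : 0 < e -> exists2 a, D a &
    forall b, D b -> (a < b)%O -> `|f a - f b| <= e.
  move=> e0; apply: contrapT => nsmall.
  have /choice[g gP] : forall a, exists b, D a ->
      [/\ D b, (a < b)%O & ~~ (`|f a - f b| <= e)].
    move=> a; apply: contrapT => /forallNP na.
    have Da : D a by apply: contrapT => nDa; apply: (na a).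
    apply: nsmall; exists a => // b Db ab; apply: contrapT => /negP nab.
    by apply: (na b).
  (* From a point of D, iterate g to get infinitely many jumps larger than e. *)
  have [a Da] : exists a, D a.
    have [a _] := omega1_nonempty.
    by have [b Db _] := uD a; exists b.
  pose u n := iter n g a.
  have Du n : D (u n) by elim: n => //= n /gP[].
  have [|n] := fu u Du _ e e0; first by move=> n; have [] := gP _ (Du n).
  by have [_ _ /negP] := gP _ (Du n).
have /choice[a aP] : forall n : nat, exists a, D a /\
    forall b, D b -> (a < b)%O -> `|f a - f b| <= n.+1%:R^-1.
  by move=> n; have [|a Da aP] := small n.+1%:R^-1; [|exists a].
have ca : countable (range a) by apply: sub_countable (card_image_le _ _) _.
have [c ac] := omega1_countable_lt ca.
have [d Dd cd] := uD c.
exists (f d), c => b cb Db; apply/eqP; rewrite -subr_eq0 -normr_le0.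
apply/ler_addgt0Pr => e e0; rewrite add0r.
have [n ne] := complex_archi (divr_gt0 e0 (ltr0Sn _ 1)).
have anc : (a n < c)%O by apply: ac; exists n.
have [_ an] := aP n.
rewrite -(subrK (f (a n)) (f b)) -addrA (splitr e) (le_trans (ler_normD _ _))// lerD//.
  by rewrite distrC (le_trans (an _ _ _))// ?(ltW ne)// (lt_trans anc).
by rewrite (le_trans (an _ _ _))// ?(ltW ne)// (lt_trans anc).
Qed.

(** * The space Y_X *)

Lemma omega1_succ_ltE (a b : omega1) :
  ((Some a : omega1_succ) < (Some b : omega1_succ))%O = (a < b)%O.
Proof. by rewrite !ltNge. Qed.

Lemma bop_dense_eq0 {R : realType} (V W : normedModType R[i]) (A : set V)
    (L : bop V W) : dense A -> (forall a, A a -> L a = 0) -> forall v, L v = 0.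
Proof.
move=> dA LA v; apply/eqP; rewrite -normr_le0; apply/ler_addgt0Pr => e e0.
have L1 : 0 < `|L| + 1 by rewrite ltr_wpDl.
rewrite add0r; have [a Aa va] := dense_approx v dA (divr_gt0 e0 L1).
rewrite -(subrK a v) linearD/= (LA a Aa) addr0 (le_trans (bop_norm_le _ _))//.
rewrite (@le_trans _ _ ((`|L| + 1) * `|v - a|))//.
  by rewrite ler_wpM2r// lerDl.
by rewrite mulrC -ler_pdivlMr// ltW.
Qed.

Lemma nbhs_initial (a : omega1) (t : omega1_succ) :
  nbhs t [set r | (r <= (Some a : omega1_succ))%O = (t <= (Some a : omega1_succ))%O].
Proof.
have [s sE] := omega1_succ_elem a.
have leE (r : omega1_succ) : (r <= (Some a : omega1_succ))%O = (r < (Some s : omega1_succ))%O.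
  case: r => [r|]; last by rewrite ltNge.
  by rewrite omega1_succ_ltE sE.
have [ta|ta] := boolP (t <= (Some a : omega1_succ))%O.
- have : nbhs t [set` `]-oo, (Some s : omega1_succ)[].
    by apply: open_nbhs_nbhs; split; [exact: lray_open|rewrite /= in_itv/= -leE].
  by apply: filterS => r /=; rewrite in_itv/= -leE.
- have : nbhs t [set` `](Some a : omega1_succ), +oo[].
    apply: open_nbhs_nbhs; split; first exact: rray_open.
    by rewrite /= in_itv/= andbT ltNge.
  by apply: filterS => r /=; rewrite in_itv/= andbT leNgt => ->.
Qed.

Section YX.
Context {R : realType} {X : normedModType R[i]}.
Implicit Types (F G : YX X) (a b : omega1) (x : X).

Lemma YX_norm_le F (M : R[i]) : (forall t, `|F t| <= M) -> `|F| <= M.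
Proof. by move=> FM; apply: sup_norm_le => //; exists None. Qed.

Lemma YX_left_limit F (t s : omega1_succ) (e : R[i]) : (s < t)%O -> 0 < e ->
  exists2 r, (r < t)%O & forall t', (r < t')%O -> (t' <= t)%O -> `|F t - F t'| < e.
Proof.
move=> st e0; apply: (nbhs_left_interval st (B := [set t' | `|F t - F t'| < e])).
by have /cvgrPdist_lt/(_ _ e0) := @YX_continuous R X F t.
Qed.

Lemma YX_eventually0 F : exists a, forall b, (a < b)%O -> F (Some b) = 0.
Proof.
have [|n _|a aP] := @countable_eventually nat setT
    (fun n => [set b | `|F (Some b)| < n.+1%:R^-1]).
- exact: countableP.
- have [d _] := omega1_nonempty.
  have dT : ((Some d : omega1_succ) < None)%O by rewrite ltNge.
  have ne : 0 < n.+1%:R^-1 :> R[i] by rewrite invr_gt0 ltr0Sn.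
  have [[r|//] _ rP] := YX_left_limit F dT ne.
  exists r => b rb /=; have := rP (Some b).
  by rewrite (YX_top F) sub0r normrN omega1_succ_ltE; apply.
exists a => b /aP bP; apply/eqP; rewrite -normr_le0; apply/ler_addgt0Pr => e e0.
have [n ne] := complex_archi e0; rewrite add0r ltW// (lt_trans _ ne)//.
exact: bP.
Qed.

Let eval_subproof (t : omega1_succ) : (fun F : YX X => F t) \in @bop_pred R (YX X) X.
Proof.
by rewrite inE; split => //; exists 1 => F; rewrite mul1r YX_norm_ub.
Qed.

Definition YX_eval (t : omega1_succ) : bop (YX X) X := Bop (eval_subproof t).

Let step_fun a x (t : omega1_succ) := if (t <= (Some a : omega1_succ))%O then x else 0.

Let step_subproof a x : step_fun a x \in @YX_pred R X.
Proof.
rewrite inE; split => // t.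
apply: (@cvg_near_cst _ _ _ _ (nbhs (t : omega1_succ)) (nbhs_filter (t : omega1_succ))).
by apply: filterS (nbhs_initial a t) => r rt; rewrite /step_fun rt.
Qed.

Let step_YX a x := MkYX (step_subproof a x).

Let step_bop_subproof a : step_YX a \in @bop_pred R X (YX X).
Proof.
rewrite inE; split.
  move=> k x y; apply/val_inj/funext => t.
  rewrite /= -[RHS]/(k *: step_fun a x t + step_fun a y t) /step_fun.
  by case: ifP => // _; rewrite scaler0 addr0.
exists 1 => x; rewrite mul1r; apply: YX_norm_le => t.
by rewrite /= /step_fun; case: ifP => // _; rewrite normr0.
Qed.

(** The tensor 1_[0, a] (x) x, which is continuous since [0, a] is clopen. *)
Definition step a : bop X (YX X) := Bop (step_bop_subproof a).

Lemma stepE a x t : step a x t = if (t <= (Some a : omega1_succ))%O then x else 0.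
Proof. by []. Qed.

Lemma norm_step_le a x : `|step a x| <= `|x|.
Proof.
by apply: YX_norm_le => t; rewrite stepE; case: ifP => // _; rewrite normr0.
Qed.

End YX.

(** * Step functions: density and values of operators on them *)

Section Steps.
Context {R : realType} {X : normedModType R[i]}.
Implicit Types (F G : YX X) (a b : omega1) (x : X).

(** Steps span a dense subspace of Y_X: a least point t such that F cannot be
    approximated on [0, t] does not exist, because F is nearly constant on some
    interval (r, t] and 1_(r, t] (x) F t is a difference of steps. *)
Lemma step_total (V : normedModType R[i]) (L : bop (YX X) V) :
  (forall a x, L (step a x) = 0) -> forall F, L F = 0.
Proof.
move=> L0 F.
have approx (e : R[i]) (t : omega1_succ) : 0 < e -> exists G, [/\ L G = 0,
    forall s, (s <= t)%O -> `|F s - G s| <= e &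
    forall s, (t < s)%O -> G s = 0].
  move=> e0; apply: contrapT => nt.
  have [|{nt}t bad tmin] := @omega1_succ_wf (fun t : omega1_succ => ~ exists G, [/\ L G = 0,
    forall s, (s <= t)%O -> `|F s - G s| <= e & forall s, (t < s)%O -> G s = 0]).
    by exists t.
  have good r : (r < t)%O -> exists G, [/\ L G = 0,
      forall s, (s <= r)%O -> `|F s - G s| <= e & forall s, (r < s)%O -> G s = 0].
    by move=> rt; apply: contrapT => /tmin; rewrite leNgt rt.
  apply: bad; have [[r0 r0t]|t0] := pselect (exists r, (r < t)%O).
    have [r rt rF] := YX_left_limit F r0t e0.
    have [G [LG FG G0]] := good r rt.
    case: t rt rF {tmin good r0t} => [a|] rt rF.
      case: r rt rF FG G0 => [b|//] ba bF FG G0.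
      pose x := F (Some a).
      (* G ends at b; the added term continues it with the constant value x on (b, a]. *)
      exists (G + (step a x - step b x)); split.
      - by rewrite linearD linearB/= !L0 LG subr0 addr0.
      - move=> s sa.
        have -> : (G + (step a x - step b x)) s = G s + (step a x s - step b x s) by [].
        rewrite !stepE sa; have [sb|bs] := leP s (Some b).
          by rewrite subrr addr0; exact: FG.
        by rewrite subr0 G0// add0r distrC ltW// bF.
      - move=> s a_s.
        have -> : (G + (step a x - step b x)) s = G s + (step a x s - step b x s) by [].
        have bs : ((Some b : omega1_succ) < s)%O by exact: lt_trans a_s.
        by rewrite !stepE leNgt a_s/= leNgt bs/= subr0 addr0 G0.
    exists G; split=> // [s sT|s]; last by rewrite ltNge; case: s.
    have [sr|rs] := leP s r; first exact: FG.
    rewrite G0// subr0; have := rF s rs sT; rewrite (YX_top F) sub0r normrN.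
    exact: ltW.
  case: t {tmin good} t0 => [a|] t0; last first.
    case: t0; have [d _] := omega1_nonempty.
    by exists (Some d); rewrite ltNge.
  exists (step a (F (Some a))); split => // [s sa|s a_s].
    have -> : s = Some a.
      by apply/le_anti; rewrite sa leNgt; apply/negP => s_a; apply: t0; exists s.
    by rewrite stepE lexx subrr normr0 ltW.
  by rewrite stepE leNgt a_s.
apply/eqP; rewrite -normr_le0; apply/ler_addgt0Pr => e e0.
have L1 : 0 < `|L| + 1 by rewrite ltr_wpDl.
have [G [LG FG _]] := approx (e / (`|L| + 1)) None (divr_gt0 e0 L1).
have FGn : `|F - G| <= e / (`|L| + 1).
  by apply: YX_norm_le => t; apply: FG; case: t.
rewrite add0r -(subrK G F) linearD/= LG addr0 (le_trans (bop_norm_le _ _))//.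
rewrite (@le_trans _ _ ((`|L| + 1) * `|F - G|))//.
  by rewrite ler_wpM2r// lerDl.
by rewrite mulrC -ler_pdivlMr.
Qed.

(** The function a |-> phi (step a x) has bounded variation: its jumps along an
    increasing sequence, rotated to be positive, add up to the value of phi at
    an element of norm at most |x|, since the intervals (u n, u n.+1] are
    disjoint. *)
Lemma step_small_jump (phi : dual_space (YX X)) x (u : nat -> omega1) (e : R[i]) :
  (forall n, (u n < u n.+1)%O) -> 0 < e ->
  exists n, `|phi (step (u n) x) - phi (step (u n.+1) x)| <= e.
Proof.
move=> umon e0; apply: contrapT => /forallNP big.
pose d n := step (u n.+1) x - step (u n) x.
have phid n : e < `|phi (d n)|.
  have := big n; rewrite distrC -linearB/= => /negP.
  by rewrite -real_ltNge// gtr0_real.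
have phid0 n : `|phi (d n)| != 0 by rewrite gt_eqF// (lt_trans e0).
pose w n := `|phi (d n)| / phi (d n).
have w1 n : `|w n| = 1 by rewrite normrM normr_id normfV mulfV.
have ind n t : `|d n t| = (((t <= (Some (u n.+1) : omega1_succ))%O)%:R
    - ((t <= (Some (u n) : omega1_succ))%O)%:R) * `|x|.
  have -> : d n t = step (u n.+1) x t - step (u n) x t by [].
  rewrite !stepE; have [tu|ut] := leP t (Some (u n)).
    have -> : (t <= (Some (u n.+1) : omega1_succ))%O.
      by rewrite (le_trans tu)// ltW// omega1_succ_ltE.
    by rewrite !subrr normr0 mul0r.
  by rewrite !subr0; case: ifP => _; rewrite ?mul1r ?mul0r ?normr0.
have bound N : N%:R * e <= `|phi| * `|x|.
  (* The factors w n turn the values phi (d n) into their absolute values. *)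
  pose G := \sum_(0 <= n < N) w n *: d n.
  have Gx : `|G| <= `|x|.
    apply: YX_norm_le => t; rewrite -[G t]/(YX_eval t G) linear_sum/=.
    apply: le_trans (ler_norm_sum _ _ _) _.
    under eq_bigr => n _ do rewrite -[X in `|X|]/(w n *: d n t) normrZ w1 mul1r ind.
    rewrite -mulr_suml.
    rewrite (telescope_sumr (fun n => ((t <= (Some (u n) : omega1_succ))%O)%:R : R[i]))//.
    rewrite -[leRHS]mul1r ler_wpM2r// lerBlDr.
    by apply: le_trans (_ : 1 <= _); [rewrite lern1 leq_b1|rewrite lerDl].
  have phiG : phi G = \sum_(0 <= n < N) `|phi (d n)|.
    rewrite linear_sum/=; apply: eq_bigr => n _.
    by rewrite linearZ/= /GRing.scale/= /w mulfVK// -normr_eq0.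
  apply: (@le_trans _ _ `|phi G|); last first.
    by rewrite (le_trans (bop_norm_le _ _))// ler_wpM2l.
  rewrite phiG ger0_norm; last by apply: sumr_ge0 => n _.
  rewrite mulr_natl -[X in _ *+ X]subn0 -sumr_const_nat.
  by apply: ler_sum => n _; exact: ltW.
have M1 : 0 < `|phi| * `|x| + 1 by rewrite ltr_wpDl// mulr_ge0.
have [n] := complex_archi (divr_gt0 e0 M1).
rewrite ltr_pdivlMr// mulrC -ltr_pdivlMr ?invr_gt0 ?ltr0Sn// invrK => Mn.
have := lt_le_trans Mn; rewrite mulrC => /(_ _ (bound n.+1)).
by rewrite gtrDl ltr10.
Qed.

Lemma functional_step_eventually_cst (phi : dual_space (YX X)) x :
  exists c, exists a, forall b, (a < b)%O -> phi (step b x) = c.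
Proof.
have [||c [a ca]] := @eventually_cst R R[i]^o setT (fun b => phi (step b x)).
- by move=> a; have [b ab] := omega1_gt a; exists b.
- by move=> u _ umon e e0; exact: step_small_jump.
by exists c, a => b /ca; apply.
Qed.

Lemma operator_step_eventually_cst (A : bop (YX X) X) : separable_space X ->
  exists a, forall b b', (a < b)%O -> (a < b')%O ->
    forall x, A (step b x) = A (step b' x).
Proof.
move=> sX; have [B cB dB] := sX; have [Psi cPsi PsiP] := separable_separating_dual sX.
have /choice[c cP] : forall p : X * dual_space X, exists c, exists a,
    forall b, (a < b)%O -> p.2 (A (step b p.1)) = c.
  by move=> [x psi] /=; exact: functional_step_eventually_cst (adjoint A psi) x.
have [//||a aP] := @countable_eventually _ (B `*` Psi)
    (fun p => [set b | p.2 (A (step b p.1)) = c p]).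
- exact: countableX.
- by move=> p _; exact: cP.
exists a => b b' ab ab'.
pose L : bop X X := bop_comp A (step b) - bop_comp A (step b').
have L0 : forall x, L x = 0.
  apply: (bop_dense_eq0 dB) => x Bx; apply: PsiP => psi Ppsi.
  have -> : L x = A (step b x) - A (step b' x) by [].
  have Bp : (B `*` Psi) (x, psi) by [].
  by rewrite linearB/= (aP b ab _ Bp) (aP b' ab' _ Bp) subrr.
move=> x; apply/eqP; rewrite -subr_eq0; apply/eqP; exact: L0.
Qed.

Lemma step_image_eventually0 (S : bop (YX X) (YX X)) a : separable_space X ->
  exists c, forall b, (c < b)%O -> forall x, S (step a x) (Some b) = 0.
Proof.
move=> [B cB dB].
have [//||c cP] := @countable_eventually _ B
    (fun x => [set b | S (step a x) (Some b) = 0]).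
  by move=> x _; exact: YX_eventually0.
exists c => b /cP bP.
exact: (bop_dense_eq0 dB (L := bop_comp (YX_eval (Some b)) (bop_comp S (step a)))).
Qed.

End Steps.

(** * The operator on X induced by an operator on Y_X *)

Lemma bop_norm_ub {R : realType} (V W : normedModType R[i]) (T : bop V W) (M : R[i]) :
  0 <= M -> (forall x, `|T x| <= M * `|x|) -> `|T| <= M.
Proof.
move=> M0 TM; rewrite bop_normE; apply: sup_norm_le; first by exists 0; rewrite /= normr0.
by move=> x /= x1; rewrite (le_trans (TM x))// ler_piMr.
Qed.

Section Representation.
Context {R : realType} {X : normedModType R[i]}.
Implicit Types (S : bop (YX X) (YX X)) (T : bop X X) (F : YX X).

(** The pairing-free form of the condition that defines Theta S. *)
Definition represents S T := exists2 D : set omega1, club D &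
  forall a, D a -> forall F, S F (Some a) = T (F (Some a)).

Lemma represents_unique S T T' : represents S T -> represents S T' -> T = T'.
Proof.
move=> [D cD SD] [D' cD' SD']; have [a0 _] := omega1_nonempty.
have [_ /(_ a0)[a [Da D'a] _]] := clubI cD cD'.
apply/val_inj/funext => x /=.
by have := SD a Da (step a x); rewrite SD'// stepE lexx.
Qed.

Lemma represents_linear k S S' T T' : represents S T -> represents S' T' ->
  represents (k *: S + S') (k *: T + T').
Proof.
move=> [D cD SD] [D' cD' SD']; exists (D `&` D'); first exact: clubI.
move=> a [Da D'a] F.
by rewrite -[LHS]/(k *: S F (Some a) + S' F (Some a)) SD// SD'.
Qed.

Lemma represents_comp S S' T T' : represents S T -> represents S' T' ->
  represents (bop_comp S S') (bop_comp T T').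
Proof.
move=> [D cD SD] [D' cD' SD']; exists (D `&` D'); first exact: clubI.
by move=> a [Da D'a] F /=; rewrite SD// SD'.
Qed.

(** By totality of the steps it is enough to find T and a club of a such that
    S (step b x) has at a the value T x if a <= b, and 0 if b < a. *)
Lemma represented S : separable_space X ->
  exists2 T, `|T| <= `|S| & represents S T.
Proof.
move=> sX; have [B cB dB] := sX.
(* Requiring a < h a makes every nonzero ordinal closed under h a limit. *)
have /choice[h hP] : forall a, exists c, [/\ (a < c)%O,
    forall b, (c < b)%O -> forall x, S (step a x) (Some b) = 0 &
    forall b b', (c < b)%O -> (c < b')%O ->
      forall x, S (step b x) (Some a) = S (step b' x) (Some a)].
  move=> a; have [c1 c1P] := step_image_eventually0 S a sX.
  have [c2 c2P] := operator_step_eventually_cst (bop_comp (YX_eval (Some a)) S) sX.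
  have [c3 ac3] := omega1_gt a.
  exists (Order.max c3 (Order.max c1 c2)); split.
  - by rewrite (lt_le_trans ac3)// le_max lexx.
  - by move=> b; rewrite !gt_max => /and3P[_ + _]; exact: c1P.
  - move=> b b'; rewrite !gt_max => /and3P[_ _ bc] /and3P[_ _ b'c] x.
    exact: (c2P b b' bc b'c x).
have [z _] := omega1_nonempty.
have [z1 zz1] := omega1_gt z.
(* The bound z1, above the point z, removes the least element, which is
   vacuously closed under h. *)
pose D0 := [set a | forall b, (b < a)%O -> (h b < a)%O] `&` [set a | (z1 <= a)%O].
have cD0 : club D0 by apply: clubI; [exact: club_closed_under|exact: club_ge].
have D0lim a r : D0 a -> (r < (Some a : omega1_succ))%O ->
    exists2 b, (r < (Some b : omega1_succ))%O & (b < a)%O.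
  move=> [ha z1a]; case: r => [r|//]; rewrite omega1_succ_ltE => ra.
  have [rh _ _] := hP r; exists (h r); last exact: ha.
  by rewrite omega1_succ_ltE.
have D0gt a : D0 a -> ((Some z : omega1_succ) < Some a)%O.
  by move=> [_ z1a]; rewrite omega1_succ_ltE (lt_le_trans zz1).
(* S (step b x) and S (step a x) are continuous and agree at every c < a, as
   h c < a <= b; these c are cofinal in the limit a. *)
have large a b x : D0 a -> (a <= b)%O ->
    S (step b x) (Some a) = S (step a x) (Some a).
  move=> Da ab; apply/eqP; rewrite -subr_eq0 -normr_le0; apply/ler_addgt0Pr => e e0.
  pose F := S (step b x) - S (step a x).
  have [r ra rF] := YX_left_limit F (D0gt a Da) e0.
  have [c rc ca] := D0lim a r Da ra.
  have := rF (Some c) rc (ltW ca).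
  have [ha _] := Da; have [_ _ hc] := hP c.
  have -> : F (Some c) = S (step b x) (Some c) - S (step a x) (Some c) by [].
  rewrite (hc b a) ?ha// ?(lt_le_trans (ha c ca))// subrr subr0 add0r.
  exact: ltW.
have small a b x : D0 a -> (b < a)%O -> S (step b x) (Some a) = 0.
  by move=> [ha _] ba; have [_ + _] := hP b; apply; exact: ha.
(* Along u increasing to l, S (step (u n) x) (Some (u n)) is the value at u n of the
   single continuous function S (step l x). *)
have ev x : exists c, exists a, forall b, (a < b)%O -> D0 b -> S (step b x) (Some b) = c.
  apply: eventually_cst; first by have [] := cD0.
  move=> u uD umon e e0; have [l [ul lu]] := omega1_seq_lub umon.
  pose F := S (step l x).
  have FE n : S (step (u n) x) (Some (u n)) = F (Some (u n)).
    by rewrite /F (large (u n) l)// ltW.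
  have ul0 : ((Some (u 0%N) : omega1_succ) < Some l)%O by rewrite omega1_succ_ltE.
  have [[r|//] rl rF] := YX_left_limit F ul0 (divr_gt0 e0 (ltr0Sn _ 1)).
  move: rl; rewrite omega1_succ_ltE => /lu[n rn]; exists n.
  have close m : (r < u m)%O -> `|F (Some l) - F (Some (u m))| <= e / 2.
    by move=> rm; apply/ltW/rF; rewrite ?omega1_succ_ltE// ltW// omega1_succ_ltE.
  rewrite !FE -(subrK (F (Some l)) (F (Some (u n)))) -addrA (splitr e).
  rewrite (le_trans (ler_normD _ _))// lerD//.
    by rewrite distrC close.
  by apply: close; exact: lt_trans (umon n).
have /choice[c cP] := ev.
have [//||g gP] := @countable_eventually _ B
    (fun x => [set b | D0 b -> S (step b x) (Some b) = c x]).
  by move=> x _; exact: cP.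
have [_ uD0] := cD0; have [a Da ga] := uD0 g.
pose T := bop_comp (YX_eval (Some a)) (bop_comp S (step a)).
have TE x b : D0 b -> (g < b)%O -> S (step b x) (Some b) = T x.
  move=> Db gb.
  pose L := T - bop_comp (YX_eval (Some b)) (bop_comp S (step b)).
  have L0 : L x = 0.
    apply: (bop_dense_eq0 dB) => y By.
    have -> : L y = S (step a y) (Some a) - S (step b y) (Some b) by [].
    by rewrite (gP a ga y By Da) (gP b gb y By Db) subrr.
  by apply/eqP; rewrite eq_sym -subr_eq0 -[X in X == 0]/(L x) L0.
exists T.
  apply: bop_norm_ub => // x; rewrite (le_trans (YX_norm_ub (S (step a x)) _))//.
  by rewrite (le_trans (bop_norm_le S _))// ler_wpM2l// norm_step_le.
have [g1 gg1] := omega1_gt g.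
exists (D0 `&` [set b | (g1 <= b)%O]); first by apply: clubI => //; exact: club_ge.
move=> b [Db /(lt_le_trans gg1) gb] F; apply/eqP; rewrite -subr_eq0; apply/eqP.
pose L := bop_comp (YX_eval (Some b)) S - bop_comp T (YX_eval (Some b)).
rewrite -[LHS]/(L F); apply: step_total => d x.
have -> : L (step d x) = S (step d x) (Some b) - T (step d x (Some b)) by [].
have [bd|db] := leP b d; rewrite stepE.
  by rewrite ifT// large// TE// subrr.
rewrite small// ifF; first by rewrite linear0 subrr.
by apply/negbTE; rewrite -ltNge omega1_succ_ltE.
Qed.

Lemma representsP S T : represents S T <->
  exists D : set omega1, club D /\ forall a, D a -> forall psi : dual_space X,
    adjoint S (delta_tensor (omega1_incl a) psi) =
    delta_tensor (omega1_incl a) (adjoint T psi).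
Proof.
split=> [[D cD SD]|[D [cD SD]]].
  exists D; split => // a Da psi; apply/val_inj/funext => F.
  by rewrite -[LHS]/(psi (S F (Some a))) SD.
exists D => // a Da F; apply/eqP; rewrite -subr_eq0 -normr_eq0; apply/eqP.
have [psi [_ <-]] := hahn_banach_norm (S F (Some a) - T (F (Some a))).
have := congr1 (fun phi : dual_space (YX X) => phi F) (SD a Da psi).
rewrite -[LHS]/(psi (S F (Some a))) -[RHS]/(psi (T (F (Some a)))) => E.
by rewrite linearB/= E subrr normr0.
Qed.

End Representation.

(** * Composition operators on Y_X *)

Section Composition.
Context {R : realType} {X : normedModType R[i]}.

Let postcomp_fun_subproof (T : bop X X) (F : YX X) : T \o F \in @YX_pred R X.
Proof.
rewrite inE; split; last by rewrite /= (YX_top F) linear0.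
move=> t; suff : (T \o F) @ nbhs (t : omega1_succ) --> T (F t) by [].
apply/cvgrPdist_lt => e e0.
have T1 : 0 < `|T| + 1 by rewrite ltr_wpDl.
have := @YX_continuous R X F t => /cvgrPdist_lt/(_ _ (divr_gt0 e0 T1)).
apply: filterS => s Fs; rewrite /= -linearB/=.
rewrite (le_lt_trans (bop_norm_le _ _))//.
rewrite (@le_lt_trans _ _ ((`|T| + 1) * `|F t - F s|))//.
  by rewrite ler_wpM2r// lerDl.
by rewrite mulrC -ltr_pdivlMr.
Qed.

Let postcomp_YX (T : bop X X) (F : YX X) := MkYX (postcomp_fun_subproof T F).

Let postcomp_subproof (T : bop X X) : postcomp_YX T \in @bop_pred R (YX X) (YX X).
Proof.
rewrite inE; split.
  move=> k F G; apply/val_inj/funext => t /=.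
  rewrite -[RHS]/(k *: T (F t) + T (G t)) -linearP//.
exists `|T| => F; apply: YX_norm_le => t /=.
by rewrite (le_trans (bop_norm_le _ _))// ler_wpM2l// YX_norm_ub.
Qed.

Definition postcomp (T : bop X X) : bop (YX X) (YX X) := Bop (postcomp_subproof T).

Lemma postcomp_norm_le (T : bop X X) : `|postcomp T| <= `|T|.
Proof.
apply: bop_norm_ub => // F; apply: YX_norm_le => t /=.
by rewrite (le_trans (bop_norm_le _ _))// ler_wpM2l// YX_norm_ub.
Qed.

Let postcomp_bop_subproof :
  postcomp \in @bop_pred R (bop X X) (bop (YX X) (YX X)).
Proof.
rewrite inE; split.
  by move=> k T T'; apply/val_inj/funext => F; apply/val_inj/funext.
by exists 1 => T; rewrite mul1r postcomp_norm_le.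
Qed.

Definition postcomp_bop : bop (bop X X) (bop (YX X) (YX X)) :=
  Bop postcomp_bop_subproof.

Lemma represents_postcomp (T : bop X X) : represents (postcomp T) T.
Proof.
have [z _] := omega1_nonempty.
by exists [set x | (z <= x)%O] => //; exact: club_ge.
Qed.

End Composition.

Section Noninjectivity.
Context {R : realType} {X : normedModType R[i]}.

(** The witness that Theta is not injective: all its values vanish beyond a. *)
Definition step_projection (a : omega1) : bop (YX X) (YX X) :=
  bop_comp (step a) (YX_eval (Some a)).

Lemma represents_step_projection (a : omega1) : represents (step_projection a) 0.
Proof.
have [b ab] := omega1_gt a; exists [set c | (b <= c)%O]; first exact: club_ge.
move=> c /(lt_le_trans ab) ac F.
rewrite -[LHS]/(step a (F (Some a)) (Some c)) stepE ifF//.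
by apply/negbTE; rewrite -ltNge omega1_succ_ltE.
Qed.

Lemma step_projection_neq0 (a : omega1) (x : X) : x != 0 -> step_projection a != 0.
Proof.
apply: contraNneq => p0.
have := congr1 (fun S : bop (YX X) (YX X) => S (step a x) (Some a)) p0.
by rewrite -[LHS]/(step a (step a x (Some a)) (Some a)) !stepE !lexx => ->.
Qed.

End Noninjectivity.

Theorem theorem1p7 (R : realType) (X : completeNormedModType R[i])
    (X_nonzero : exists x : X, x != 0)
    (X_separable : separable_space X)
    (X_reflexive : reflexive_space X) :
  exists Theta : bop (bop (YX X) (YX X)) (bop X X),
    (forall S : bop (YX X) (YX X),
       unique
         (fun T : bop X X =>
            exists D : set omega1, club D /\
              forall a : omega1, D a -> forall psi : dual_space X,
                adjoint S (delta_tensor (omega1_incl a) psi) =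
                delta_tensor (omega1_incl a) (adjoint T psi))
         (Theta S)) /\
    algebra_hom Theta /\
    `|Theta| = 1 /\
    ~ injective Theta /\
    (exists Lambda : bop (bop X X) (bop (YX X) (YX X)),
       algebra_hom Lambda /\
       `|Lambda| = 1 /\
       (forall T : bop X X, Theta (Lambda T) = T)) /\
    (forall T : bop X X, exists S : bop (YX X) (YX X), Theta S = T).
Proof.
have [x0 x0_neq0] := X_nonzero.
have /choice[theta thetaP] : forall S : bop (YX X) (YX X),
    exists T : bop X X, `|T| <= `|S| /\ represents S T.
  by move=> S; have [T] := represented S X_separable; exists T.
have thetaE S T : represents S T -> theta S = T.
  by apply: represents_unique; have [] := thetaP S.
have thetaB : theta \in @bop_pred R (bop (YX X) (YX X)) (bop X X).
  rewrite inE; split; last by exists 1 => S; rewrite mul1r; have [] := thetaP S.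
  move=> k S S'; apply: thetaE; apply: represents_linear.
  - by have [] := thetaP S.
  - by have [] := thetaP S'.
pose Theta : bop (bop (YX X) (YX X)) (bop X X) := Bop thetaB.
have ThetaK (T : bop X X) : Theta (postcomp_bop T) = T.
  by apply: thetaE; exact: represents_postcomp.
have Theta_le : `|Theta| <= 1.
  by apply: bop_norm_ub => // S; rewrite mul1r; have [] := thetaP S.
have Lambda_le : `|@postcomp_bop R X| <= 1.
  by apply: bop_norm_ub => // T; rewrite mul1r postcomp_norm_le.
have id_subproof : idfun \in @bop_pred R X X.
  by rewrite inE; split => //; exists 1 => x; rewrite mul1r.
pose I : bop X X := Bop id_subproof.
have I_gt0 : 0 < `|I|.
  rewrite normr_gt0; apply: contraNneq x0_neq0 => I0.
  by have := congr1 (fun T : bop X X => T x0) I0 => /= ->.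
have I_le : `|I| <= `|Theta| * (`|@postcomp_bop R X| * `|I|).
  rewrite -{1}(ThetaK I) (le_trans (bop_norm_le _ _))//.
  by rewrite ler_wpM2l// bop_norm_le.
exists Theta; split; [|split; [|split; [|split; [|split]]]].
- move=> S; split; first by apply/representsP; have [] := thetaP S.
  by move=> T /representsP; exact: thetaE.
- move=> S S'; apply: thetaE; apply: represents_comp.
  + by have [] := thetaP S.
  + by have [] := thetaP S'.
- apply/le_anti; rewrite Theta_le/= -(ler_pM2r I_gt0) mul1r (le_trans I_le)//.
  by rewrite ler_wpM2l// ler_piMl// ltW.
- have [z _] := omega1_nonempty.
  move=> inj; have /negP[] := step_projection_neq0 z x0_neq0.
  apply/eqP/inj; rewrite linear0; apply: thetaE.
  exact: represents_step_projection.
- exists postcomp_bop; split; [|split] => //.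
    by move=> T T'; apply/val_inj/funext => F; apply/val_inj/funext.
  apply/le_anti; rewrite Lambda_le/= -(ler_pM2r I_gt0) mul1r (le_trans I_le)//.
  by rewrite ler_piMl// mulr_ge0.
- by move=> T; exists (postcomp_bop T).
Qed.
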